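(* The scheme $\sim(\sim(\alpha\vee\beta)\vee\gamma)\rightarrow_{d}(\sim(\sim\alpha\vee\gamma)\vee\sim(\sim\beta\vee\gamma))$ is not provable in the axiom system $\mathrm{C}$; that is, there are formulas $\alpha,\beta,\gamma$ such that $\sim(\sim(\alpha\vee\beta)\vee\gamma)\rightarrow_{d}(\sim(\sim\alpha\vee\gamma)\vee\sim(\sim\beta\vee\gamma))$ is not a theorem of $\mathrm{C}$.
   Context: Formulas are built from a countably infinite set of propositional variables using the unary connective $\sim$ (negation) and the binary connectives $\vee$ (disjunction), $\rightarrow_{d}$ (discussive implication), $\wedge_{d}$ (discussive conjunction), all treated as primitive. $\sim$ binds more tightly than the binary connectives. The axiom system $\mathrm{C}$ has as its sole rule modus ponens for $\rightarrow_{d}$ (from $\alpha$ and $\alpha\rightarrow_{d}\beta$ infer $\beta$), and as axioms all instances (for arbitrary formulas $\alpha,\beta,\gamma$) of the following schemes: C1: $\alpha\rightarrow_{d}(\beta\rightarrow_{d}\alpha)$. C2: $(\alpha\rightarrow_{d}(\beta\rightarrow_{d}\gamma))\rightarrow_{d}((\alpha\rightarrow_{d}\beta)\rightarrow_{d}(\alpha\rightarrow_{d}\gamma))$. C3: $(\alpha\wedge_{d}\beta)\rightarrow_{d}\alpha$. C4: $(\alpha\wedge_{d}\beta)\rightarrow_{d}\beta$. C5: $\alpha\rightarrow_{d}(\beta\rightarrow_{d}(\alpha\wedge_{d}\beta))$. C6: $\alpha\rightarrow_{d}(\alpha\vee\beta)$. C7: $\beta\rightarrow_{d}(\alpha\vee\beta)$.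 C8: $(\alpha\rightarrow_{d}\gamma)\rightarrow_{d}((\beta\rightarrow_{d}\gamma)\rightarrow_{d}((\alpha\vee\beta)\rightarrow_{d}\gamma))$. C9: $\alpha\vee(\alpha\rightarrow_{d}\beta)$. C10: $\sim(\sim\alpha\wedge_{d}(\sim\sim\alpha\wedge_{d}\sim(\alpha\vee\sim\alpha)))$. C11: $\sim(\sim\alpha\wedge_{d}(\sim\beta\wedge_{d}\sim(\alpha\vee\beta)))\rightarrow_{d}\sim(\sim\alpha\wedge_{d}(\sim\beta\wedge_{d}(\sim\gamma\wedge_{d}\sim(\alpha\vee(\beta\vee\gamma)))))$. C12: $\sim(\sim\alpha\wedge_{d}(\sim\beta\wedge_{d}(\sim\gamma\wedge_{d}\sim(\alpha\vee(\beta\vee\gamma)))))\rightarrow_{d}\sim(\sim\alpha\wedge_{d}(\sim\gamma\wedge_{d}(\sim\beta\wedge_{d}\sim(\alpha\vee(\gamma\vee\beta)))))$. C13: $\sim(\sim\alpha\wedge_{d}(\sim\beta\wedge_{d}(\sim\gamma\wedge_{d}\sim(\alpha\vee(\beta\vee\gamma)))))\rightarrow_{d}((\alpha\vee(\beta\vee\sim\gamma))\rightarrow_{d}(\alpha\vee\beta))$. C14: $\sim(\sim\alpha\wedge_{d}\sim\beta)\rightarrow_{d}(\alpha\vee\beta)$. C15: $(\alpha\vee(\beta\vee\sim\beta))\rightarrow_{d}\sim(\sim\alpha\wedge_{d}\sim(\beta\vee\sim\beta))$. A theorem of $\mathrm{C}$ is a formula derivable from these axioms by finitely many applications of modus ponens.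 A scheme is said to be unprovable in $\mathrm{C}$ if at least one of its instances is not a theorem of $\mathrm{C}$. *)

(* Defs.v *)
(* [Var n] is the n-th of countably many propositional variables. *)
Inductive formula : Type :=
| Var : nat -> formula
| Neg : formula -> formula
| Or : formula -> formula -> formula
| DImp : formula -> formula -> formula
| DAnd : formula -> formula -> formula.

Declare Scope disc_scope.
Delimit Scope disc_scope with disc.
Bind Scope disc_scope with formula.

Notation "∼ A" := (Neg A) (at level 35, right associativity) : disc_scope.
Notation "A ∧d B" := (DAnd A B) (at level 50, left associativity) : disc_scope.
Notation "A ∨ B" := (Or A B) (at level 50, left associativity) : disc_scope.
Notation "A →d B" := (DImp A B) (at level 60, right associativity) : disc_scope.

Inductive axiomC : formula -> Prop :=
| C1 (a b : formula) : axiomC (a →d (b →d a))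
| C2 (a b c : formula) :
    axiomC ((a →d (b →d c)) →d ((a →d b) →d (a →d c)))
| C3 (a b : formula) : axiomC ((a ∧d b) →d a)
| C4 (a b : formula) : axiomC ((a ∧d b) →d b)
| C5 (a b : formula) : axiomC (a →d (b →d (a ∧d b)))
| C6 (a b : formula) : axiomC (a →d (a ∨ b))
| C7 (a b : formula) : axiomC (b →d (a ∨ b))
| C8 (a b c : formula) :
    axiomC ((a →d c) →d ((b →d c) →d ((a ∨ b) →d c)))
| C9 (a b : formula) : axiomC (a ∨ (a →d b))
| C10 (a : formula) : axiomC (∼(∼a ∧d (∼∼a ∧d ∼(a ∨ ∼a))))
| C11 (a b c : formula) :
    axiomC (∼(∼a ∧d (∼b ∧d ∼(a ∨ b)))
            →d ∼(∼a ∧d (∼b ∧d (∼c ∧d ∼(a ∨ (b ∨ c))))))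
| C12 (a b c : formula) :
    axiomC (∼(∼a ∧d (∼b ∧d (∼c ∧d ∼(a ∨ (b ∨ c)))))
            →d ∼(∼a ∧d (∼c ∧d (∼b ∧d ∼(a ∨ (c ∨ b))))))
| C13 (a b c : formula) :
    axiomC (∼(∼a ∧d (∼b ∧d (∼c ∧d ∼(a ∨ (b ∨ c)))))
            →d ((a ∨ (b ∨ ∼c)) →d (a ∨ b)))
| C14 (a b : formula) : axiomC (∼(∼a ∧d ∼b) →d (a ∨ b))
| C15 (a b : formula) :
    axiomC ((a ∨ (b ∨ ∼b)) →d ∼(∼a ∧d ∼(b ∨ ∼b))).

Inductive theoremC : formula -> Prop :=
| theoremC_axiom (a : formula) : axiomC a -> theoremC a
| theoremC_mp (a b : formula) :
    theoremC a -> theoremC (a →d b) -> theoremC b.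

(* Main.v *)
(** A three-valued counter-valuation.  Let falsity, glut and truth be ordered
    [F < B < T], with [B] and [T] designated.  Negation sends [T] to [F] and
    everything else to [T]; conjunction and implication are classical on
    designation with values in [{F, T}]; disjunction is the maximum.  This matrix
    validates C1-C15.  The axioms never force a disjunction to take the value [T]
    as opposed to [B], except those of the form [b ∨ ∼b], so the non-truth-functional
    change lowering disjunctions [∼(x ∨ y) ∨ Var n] from [T] to [B] keeps all
    axioms designated.  It makes [∼(∼(p ∨ q) ∨ r)] designated while
    [∼(∼p ∨ r)] and [∼(∼q ∨ r)] stay undesignated. *)

Require Import Defs.

Inductive value : Type := F | B | T.

Definition designated (x : value) : bool :=
  match x with F => false | _ => true end.

Definition of_bool (b : bool) : value := if b then T else F.

Definition neg_value (x : value) : value :=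
  match x with T => F | _ => T end.

Definition max_value (x y : value) : value :=
  match x, y with
  | T, _ | _, T => T
  | B, _ | _, B => B
  | F, F => F
  end.

Definition cap_at_B (x : value) : value :=
  match x with F => F | _ => B end.

Definition lowered (a b : formula) : bool :=
  match a, b with
  | Neg (Or _ _), Var _ => true
  | _, _ => false
  end.

Fixpoint eval (f : formula) : value :=
  match f with
  | Var _ => T
  | Neg a => neg_value (eval a)
  | Or a b =>
      let m := max_value (eval a) (eval b) in
      if lowered a b then cap_at_B m else m
  | DImp a b =>
      of_bool (if designated (eval a) then designated (eval b) else true)
  | DAnd a b =>
      of_bool (if designated (eval a) then designated (eval b) else false)
  end.

(** Lowering needs a variable on the right, so [b ∨ ∼b] keeps the value [T], on which C15
    depends. *)
Lemma lowered_Neg_r (a b : formula) : lowered a (∼b) = false.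
Proof. destruct a as [|[]| | |]; reflexivity. Qed.

Lemma lowered_Or_r (a b c : formula) : lowered a (b ∨ c) = false.
Proof. destruct a as [|[]| | |]; reflexivity. Qed.

Lemma lowered_DImp_r (a b c : formula) : lowered a (b →d c) = false.
Proof. destruct a as [|[]| | |]; reflexivity. Qed.

Lemma axiomC_designated (f : formula) :
  axiomC f -> designated (eval f) = true.
Proof.
  intros H; destruct H; cbn [eval];
    rewrite ?lowered_Neg_r, ?lowered_Or_r, ?lowered_DImp_r;
    (* The flags still left are split independently of the values: the axioms hold whether or not
       these disjunctions are capped. *)
    repeat match goal with
    | |- context [lowered ?x ?y] => destruct (lowered x y)
    end;
    repeat match goal with
    | |- context [eval ?x] => destruct (eval x)
    end;
    reflexivity.
Qed.

Lemma theoremC_designated (f : formula) :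
  theoremC f -> designated (eval f) = true.
Proof.
  induction 1 as [f Hf | a b _ IHa _ IHab].
  - exact (axiomC_designated f Hf).
  - cbn [eval] in IHab; rewrite IHa in IHab.
    destruct (eval b); [discriminate IHab | reflexivity | reflexivity].
Qed.

Theorem proposition2p10 :
  exists a b c : formula,
    ~ theoremC (∼(∼(a ∨ b) ∨ c) →d (∼(∼a ∨ c) ∨ ∼(∼b ∨ c))).
Proof.
  (* With all variables at [T], [∼(a ∨ b) ∨ c] drops to [B] as [c] is a variable; [∼a ∨ c] and
     [∼b ∨ c] stay [T], since [a] and [b] are not disjunctions. *)
  exists (Var 0), (Var 1), (Var 2).
  intros H; discriminate (theoremC_designated _ H).
Qed.
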